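(* Let $\mathcal{H}$ be a finite arrangement of affine lines (hyperplanes) in general position in $\mathbb{R}^2$, and let $S$ be an arbitrary subset of at most half of the chambers of $\mathcal{H}$. Assume $$|S|=\sum_{i=0}^2\binom{k}{i}$$ for some real $k\ge 1$. Then the edge boundary of $S$ in the chamber graph satisfies $$|\partial S|\ \ge\ \sum_{i=0}^1\binom{k}{i}=k+1 .$$
   Context: Chambers of $\mathcal{H}$ are the connected components of the complement in $\mathbb{R}^2$ of the union of the lines of $\mathcal{H}$. General position in $\mathbb{R}^2$: any two lines of $\mathcal{H}$ meet in exactly one point, and no three lines have a common point. Chamber graph: vertices are the chambers; two chambers are adjacent iff they share a common facet (equivalently, are separated by exactly one line of $\mathcal{H}$). The edge boundary $\partial S$ is the set of edges of the chamber graph with exactly one endpoint in $S$. For real $x$ and integer $i\ge 0$, $\binom{x}{i}:=\frac{x(x-1)\cdots(x-i+1)}{i!}$. *)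

(* Defs.v *)
From HB Require Import structures.
From mathcomp Require Import all_boot all_order all_algebra.
From mathcomp Require Import finmap.
From mathcomp Require Import all_classical all_reals all_analysis.

Set Implicit Arguments.
Unset Strict Implicit.
Unset Printing Implicit Defensive.

Import Order.TTheory GRing.Theory Num.Theory.
Import numFieldNormedType.Exports.

Local Open Scope classical_set_scope.
Local Open Scope ring_scope.

(* Junk value: [ncard A = 0] when A is infinite. *)
Definition ncard (T : choiceType) (A : set T) : nat := (#|` fset_set A|)%fset.

Definition real_binom (R : realType) (x : R) (i : nat) : R :=
  (\prod_(j < i) (x - j%:R)) / (i`!)%:R.

Section Plane.
Variable R : realType.

Notation plane := (R * R)%type.

Definition affine_line (l : set plane) : Prop :=
  exists a b c : R, (a, b) != (0, 0) /\
    l = [set p : plane | a * p.1 + b * p.2 = c].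

Definition line_arrangement (H : set (set plane)) : Prop :=
  finite_set H /\ (forall l, H l -> affine_line l).

Definition general_position (H : set (set plane)) : Prop :=
  (forall l1 l2, H l1 -> H l2 -> l1 <> l2 -> exists! p, (l1 `&` l2) p) /\
  (forall l1 l2 l3, H l1 -> H l2 -> H l3 -> l1 <> l2 -> l1 <> l3 -> l2 <> l3 ->
     l1 `&` l2 `&` l3 = set0).

Definition arr_compl (H : set (set plane)) : set plane :=
  ~` (\bigcup_(l in H) l).

Definition chambers (H : set (set plane)) : set (set plane) :=
  [set connected_component (arr_compl H) x | x in arr_compl H].

(* In the plane a facet has dimension 1; since F is convex and lies on a line,
   this means that F has at least two points. *)
Definition is_facet (H : set (set plane)) (C F : set plane) : Prop :=
  (exists2 l, H l & F = closure C `&` l) /\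
  (exists p q, [/\ F p, F q & p <> q]).

Definition adjacent (H : set (set plane)) (C D : set plane) : Prop :=
  [/\ chambers H C, chambers H D, C <> D &
      exists F, is_facet H C F /\ is_facet H D F].

Definition chamber_edges (H : set (set plane)) : set (set (set plane)) :=
  [set e | exists C D, adjacent H C D /\ e = [set C; D]].

Definition edge_boundary (H S : set (set plane)) : set (set (set plane)) :=
  [set e | chamber_edges H e /\ exists! C, (e `&` S) C].

End Plane.

(* Main.v *)
Require Import Defs.
From HB Require Import structures.
From mathcomp Require Import all_boot all_order all_algebra.
From mathcomp Require Import finmap.
From mathcomp Require Import all_classical all_reals all_analysis.
From mathcomp Require Import zify ring lra.

(** Let m be the number of boundary edges of S. The inequality follows from
    |S| <= 1 + C(m, 2) (lemma [arrangement_isoperimetry]): the hypothesis reads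
    |S| = 1 + k(k+1)/2, and x |-> 1 + x(x+1)/2 is increasing, so k <= m - 1.

    Say that a line is free if all the chambers having an edge on it lie on the
    same side of the partition into S and its complement. A line that is not
    free can be charged to a boundary edge, injectively. If it carries boundary
    edges, charge it to the first one. Otherwise crossing it never changes the
    status, but moving along it does; this happens at the crossing with some
    line j, and then both edges of j at that point are boundary edges; charge
    the second one. No edge is charged twice, because the second kind of charge
    never goes to the first boundary edge of j. So at most m lines are not free
    ([nonfree_le]).

    If no line is free, there are n <= m lines, hence at most 1 + n + C(n, 2)
    chambers, and half of that is at most 1 + C(n, 2).

    If some line l is free, then all free lines see the same status, since any
    two of them meet. Consider the chambers of the other status: these are S or
    its complement, so they are at least as many as S. Walking in a segment from
    one of them to another chamber, the first line crossed bounds it and so is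
    not free; hence such a chamber is determined by its position with respect
    to the p <= m lines that are not free, and no chamber along l has the same
    position. These p lines have at most 1 + p + C(p, 2) regions, of which l
    meets p + 1, and C(p, 2) are left ([minority_le]).

    Chambers are encoded by their sign vectors, and the argument above needs
    only a few facts on sign vectors, collected in the record [line_orders]. *)

Set Implicit Arguments.
Unset Strict Implicit.
Unset Printing Implicit Defensive.

Import Order.TTheory GRing.Theory Num.Theory.
Import numFieldNormedType.Exports.

(** * Combinatorics of sign vectors *)

Lemma leq_card_rel (A B : finType) (R : A -> B -> bool) (X : {set A})
    (Y : {set B}) :
  (forall x, x \in X -> exists2 y, y \in Y & R x y) ->
  (forall x x' y, R x y -> R x' y -> x = x') ->
  (#|X| <= #|Y|)%N.
Proof.
move=> RX Rinj; pose g y := [pick x | R x y].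
rewrite -(card_imset X Some_inj).
apply: leq_trans (leq_imset_card g Y).
apply/subset_leq_card/fintype.subsetP => _ /imsetP[x xX ->].
have [y yY Rxy] := RX x xX; apply/imsetP; exists y => //; rewrite /g.
by case: pickP => [x' Rx'y|/(_ x)]; [rewrite (Rinj _ _ _ Rxy Rx'y) | rewrite Rxy].
Qed.

Section LineOrders.
Variables (I : finType) (Sg : {set {ffun I -> bool}}).
Variables (rk : I -> I -> nat) (o : I -> I -> bool).

(** [rk i k] is the number of lines crossing line [i] before line [k] does, and
    [o i k] tells on which side of line [k] line [i] starts. Then [edge i r b] is
    the sign vector of the chamber on side [b] of the [r]-th edge of line [i],
    which lies between its crossings of rank [r.-1] and [r]. *)
Definition edge (i : I) (r : nat) (b : bool) : {ffun I -> bool} :=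
  [ffun k => if k == i then b else (rk i k < r)%N (+) o i k].

Definition agree_on (P : {set I}) (s t : {ffun I -> bool}) :=
  forall k, k \in P -> s k = t k.

(** The facts on an arrangement in general position that the counting uses.
    [edge_vertex] says that the four sign vectors around the crossing of [i] and
    [j] are the same, seen along [i] or along [j]. [first_crossing] and
    [crossing_trace] describe a segment from the chamber [s] to the chamber [t]:
    it leaves [s] through a line [j] that bounds [s] and separates the two, and
    where it crosses a given line [i] it keeps every sign common to its ends. *)
Record line_orders : Prop := LineOrders {
  edge_in : forall i r b, edge i r b \in Sg;
  edge_vertex : forall i j (e b : bool), i != j ->
    edge i (rk i j + e) b = edge j (rk j i + (b (+) o j i)) (e (+) o i j);
  rk_lt : forall i j, i != j -> ((rk i j).+1 < #|I|)%N;
  rk_inj : forall i j k, i != j -> i != k -> rk i j = rk i k -> j = k;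
  first_crossing : forall s t, s \in Sg -> t \in Sg -> s != t ->
    exists j r, [/\ (r < #|I|)%N, s j != t j & s = edge j r (s j)];
  crossing_trace : forall (P : {set I}) i s t, s \in Sg -> t \in Sg ->
    agree_on P s t -> s i != t i ->
    exists2 r, (r < #|I|)%N & agree_on P s (edge i r true) }.

Hypothesis HL : line_orders.

Definition trace (P : {set I}) (s : {ffun I -> bool}) : {ffun I -> bool} :=
  [ffun k => (k \in P) && s k].

Definition traces (P : {set I}) : {set {ffun I -> bool}} :=
  [set trace P s | s in Sg]%SET.

Definition line_traces (P : {set I}) (i : I) : {set {ffun I -> bool}} :=
  [set trace P (edge i r true) | r : 'I_#|I|]%SET.

Lemma eq_traceP P s t : trace P s = trace P t <-> agree_on P s t.
Proof.
split=> [/ffunP st k kP|st]; first by have := st k; rewrite !ffunE kP.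
by apply/ffunP => k; rewrite !ffunE; case: (boolP (k \in P)) => // /st.
Qed.

Lemma trace_sub (P Q : {set I}) s : P \subset Q -> trace P (trace Q s) = trace P s.
Proof.
move=> /fintype.subsetP PQ; apply/ffunP => k; rewrite !ffunE.
by case: (boolP (k \in P)) => // /PQ ->.
Qed.

Lemma agree_edgeP (P : {set I}) i r r' b : i \notin P ->
  agree_on P (edge i r b) (edge i r' b) <->
  (forall k, k \in P -> (rk i k < r)%N = (rk i k < r')%N).
Proof.
move=> iP; split=> H k kP; have ki : k == i = false.
- by apply: contraNF iP => /eqP <-.
- by have := H k kP; rewrite !ffunE ki => /addIb.
- by apply: contraNF iP => /eqP <-.
- by rewrite !ffunE ki H.
Qed.

Lemma card_gt0I (i : I) : (0 < #|I|)%N.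
Proof. by apply/card_gt0P; exists i. Qed.

(** The lines of [P] crossed before a moving point of line [i] form an
    increasing chain, so their number determines the trace. *)
Lemma line_traces_le (P : {set I}) i : i \notin P ->
  (#|line_traces P i| <= #|P|.+1)%N.
Proof.
move=> iP; rewrite -(card_ord #|P|.+1) -(cardsT 'I_(#|P|.+1)).
pose c r := #|[set k in P | (rk i k < r)%N]%SET|.
have cP r : (c r < #|P|.+1)%N.
  rewrite ltnS; apply/subset_leq_card/fintype.subsetP => k.
  by rewrite inE => /andP[].
apply: (@leq_card_rel _ _
  (fun x (m : 'I_(#|P|.+1)) =>
     [exists r : 'I_#|I|, (x == trace P (edge i r true)) && (c r == m)])).
  move=> _ /imsetP[r _ ->]; exists (Ordinal (cP r)); rewrite ?inE //.
  by apply/existsP; exists r; rewrite eqxx /=.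
move=> x x' m /existsP[r /andP[/eqP -> /eqP cr]] /existsP[r' /andP[/eqP -> /eqP cr']].
apply/eq_traceP/agree_edgeP => //.
wlog rr : r r' cr cr' / (r <= r')%N.
  move=> H; case/orP: (leq_total r r') => rr; first exact: H.
  by move=> k kP; rewrite (H r' r).
have /eqP E : [set k in P | (rk i k < r)%N]%SET == [set k in P | (rk i k < r')%N]%SET.
  rewrite eqEcard; apply/andP; split; last by rewrite -/(c r) -/(c r') cr cr'.
  apply/fintype.subsetP => k; rewrite !inE => /andP[-> /=] kr.
  exact: leq_trans kr rr.
by move=> k kP; move/setP: E => /(_ k); rewrite !inE kP.
Qed.

(** The first edge, and for each [k] in [P] the edge that follows the crossing
    with [k], have distinct traces. *)
Lemma line_traces_ge (P : {set I}) i : i \notin P ->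
  (#|P|.+1 <= #|line_traces P i|)%N.
Proof.
move=> iP.
have iNk k : k \in P -> i != k by move=> kP; apply: contraNneq iP => ->.
have -> : #|P|.+1 = #|None |: [set Some k | k in P]%SET|.
  rewrite cardsU1 (card_imset _ Some_inj).
  by rewrite (_ : None \notin _) //; apply/imsetP => -[].
pose thr (a : option I) := if a is Some k then (rk i k).+1 else 0%N.
apply: (@leq_card_rel _ _ (fun a x =>
   (a \in None |: [set Some k | k in P]%SET) && (x == trace P (edge i (thr a) true)))).
  move=> a aP; exists (trace P (edge i (thr a) true)); last by rewrite aP /=.
  have ra : (thr a < #|I|)%N.
    move: aP; rewrite !inE => /orP[/eqP -> | /imsetP[k kP ->]] /=.
      exact: card_gt0I i.
    exact/(rk_lt HL)/iNk.
  by apply/imsetP; exists (Ordinal ra).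
move=> a a' x /andP[aP /eqP ->] /andP[aP' /eqP /eq_traceP /(agree_edgeP _ _ _ iP)].
move: aP aP'; rewrite !inE => /orP[/eqP -> | /imsetP[k kP ->]]
  /orP[/eqP -> | /imsetP[k' kP' ->]] //= E.
- by have := E _ kP'; rewrite ltnSn ltn0.
- by have := E _ kP; rewrite ltnSn ltn0.
have := E _ kP; have := E _ kP'; rewrite !ltnSn !ltnS => k'k /esym kk'.
congr Some; apply: (rk_inj HL (iNk _ kP) (iNk _ kP')).
by apply/eqP; rewrite eqn_leq kk' k'k.
Qed.

(** Adding a line [i] splits in two exactly the regions that it meets, and there
    are at most one more of these than lines crossed. *)
Lemma traces_le (P : {set I}) : (#|traces P| <= 1 + #|P| + 'C(#|P|, 2))%N.
Proof.
move Em : #|P| => m; elim: m P Em => [|m IHm] P Em.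
  move: Em => /eqP; rewrite cards_eq0 => /eqP ->.
  rewrite -[leqRHS](cards1 ([ffun=> false] : {ffun I -> bool})).
  apply/subset_leq_card/fintype.subsetP => _ /imsetP[s _ ->]; rewrite inE.
  by apply/eqP/ffunP => k; rewrite !ffunE inE.
have /card_gt0P[i iP] : (0 < #|P|)%N by rewrite Em.
pose Q := (P :\ i)%SET.
have iQ : i \notin Q by rewrite !inE eqxx.
have QP : Q \subset P by exact: subsetDl.
have EQ : #|Q| = m by have := cardsD1 i P; rewrite iP Em add1n => -[].
pose X b := [set x in traces P | x i == b]%SET.
have -> : #|traces P| = (#|X true| + #|X false|)%N.
  rewrite -(cardsID [set x : {ffun I -> bool} | x i]%SET (traces P)).
  by congr (_ + _)%N; apply: eq_card => x; rewrite !inE ?eqb_id ?eqbF_neg // andbC.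
have Xin b : {in X b &, injective (trace Q)}.
  move=> x y; rewrite !inE => /andP[/imsetP[s _ ->] /eqP si] /andP[/imsetP[t _ ->] /eqP ti].
  rewrite !trace_sub // => /eq_traceP st; apply/eq_traceP => k kP.
  have [->|ki] := eqVneq k i; last by apply: st; rewrite !inE ki.
  by move: si ti; rewrite !ffunE iP /= => -> ->.
rewrite -(card_in_imset (Xin true)) -(card_in_imset (Xin false)).
rewrite -cardsUI.
have -> : (1 + m.+1 + 'C(m.+1, 2) = (1 + m + 'C(m, 2)) + m.+1)%N.
  by rewrite binS bin1; lia.
apply: leq_add.
  apply: leq_trans (IHm Q EQ); apply/subset_leq_card/fintype.subsetP => y.
  rewrite inE => /orP[] /imsetP[x]; rewrite inE => /andP[/imsetP[s sS ->] _] ->;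
    by apply/imsetP; exists s => //; rewrite trace_sub.
rewrite -EQ; apply: leq_trans (line_traces_le iQ).
apply/subset_leq_card/fintype.subsetP => y; rewrite inE => /andP[].
move=> /imsetP[x]; rewrite inE => /andP[/imsetP[s sS ->] /eqP si] ->.
move=> /imsetP[x']; rewrite inE => /andP[/imsetP[t tS ->] /eqP ti].
rewrite !trace_sub // => /eq_traceP st.
have sti : s i != t i by move: si ti; rewrite !ffunE iP /= => -> ->.
have [r rI] := crossing_trace HL sS tS st sti.
move/eq_traceP => ->; by apply/imsetP; exists (Ordinal rI).
Qed.

Lemma rk_onto i (r : nat) : (r.+1 < #|I|)%N -> exists2 j, i != j & rk i j = r.
Proof.
move=> rI; pose s := [seq rk i j | j <- enum (predC1 i)].
have us : uniq s.
  rewrite map_inj_in_uniq ?enum_uniq // => j k.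
  rewrite !mem_enum !inE ![_ == i]eq_sym; exact: (rk_inj HL).
have ss : {subset s <= iota 0 #|I|.-1}.
  move=> m /mapP[j]; rewrite mem_enum inE eq_sym => ij ->.
  by rewrite mem_iota add0n /=; have := rk_lt HL ij; case: (#|I|) => [|n]; lia.
have zs : (size (iota 0 #|I|.-1) <= size s)%N.
  by rewrite size_iota size_map -cardE cardC1.
have /mapP[j] : r \in s.
  by rewrite (uniq_min_size us ss zs).2 mem_iota add0n; move: rI; case: (#|I|) => [|n]; lia.
by rewrite mem_enum inE eq_sym => ij ->; exists j.
Qed.

(** The two sides of an edge of [i] differ in coordinate [i] only, which gives
    back the line; the crossings already passed give back the rank. *)
Lemma edge_eqP i i' r r' e e' : (r < #|I|)%N -> (r' < #|I|)%N ->
  edge i r true = edge i' r' e -> edge i r false = edge i' r' e' -> i = i' /\ r = r'.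
Proof.
move=> rI r'I /ffunP E /ffunP E'.
have ii' : i = i'.
  apply: contrapT => /eqP ii'; have := E i; have := E' i.
  by rewrite !ffunE eqxx (negbTE ii') => <-.
subst i'; split=> //; apply/eqP; apply: contrapT => /negP rr'.
have [k ik rk1] : exists2 k, i != k & (rk i k < r)%N != (rk i k < r')%N.
  move: rr'; rewrite neq_ltn => /orP[lt|lt].
    have [k ik kr] := rk_onto i (leq_ltn_trans lt r'I).
    by exists k => //; rewrite kr ltnn lt.
  have [k ik kr] := rk_onto i (leq_ltn_trans lt rI).
  by exists k => //; rewrite kr ltnn lt.
have := E k; rewrite !ffunE eq_sym (negbTE ik) => /addIb.
by apply/eqP.
Qed.

Section Boundary.
Variable S : {set {ffun I -> bool}}.

(** An edge is recorded as a line and a rank. *)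
Definition bdry : {set I * 'I_#|I|} :=
  [set p : I * 'I_#|I| | (edge p.1 p.2 true \in S) != (edge p.1 p.2 false \in S)]%SET.

(** The status [s0] is membership in [S]. *)
Definition free (s0 : bool) (i : I) : bool :=
  [forall r : 'I_#|I|, forall b, (edge i r b \in S) == s0].

Lemma freeP s0 i r b : free s0 i -> (r < #|I|)%N -> (edge i r b \in S) = s0.
Proof. by move=> /forallP H rI; have /forallP/(_ b)/eqP := H (Ordinal rI). Qed.

Definition nonfree : {set I} := [set i | ~~ (free true i || free false i)]%SET.

(** Line [i] is charged either to its own first boundary edge, or to an edge of
    another line that comes right after its crossing with [i] and is not the
    first boundary edge there. *)
Definition charge (i : I) (p : I * 'I_#|I|) : bool :=
  ((p.1 == i) && [forall r : 'I_#|I|, (r < p.2)%N ==> ((i, r) \notin bdry)])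
  || [&& p.1 != i, p.2 == (rk p.1 i).+1 :> nat &
       [exists r : 'I_#|I|, (r < p.2)%N && ((p.1, r) \in bdry)]].

Lemma charge_inj i i' p : charge i p -> charge i' p -> i = i'.
Proof.
have aux j j' (q : I * 'I_#|I|) : (q.1 == j) && [forall r : 'I_#|I|, (r < q.2)%N ==> ((j, r) \notin bdry)] ->
  [&& q.1 != j', q.2 == (rk q.1 j').+1 :> nat &
       [exists r : 'I_#|I|, (r < q.2)%N && ((q.1, r) \in bdry)]] -> False.
  move=> /andP[/eqP <- /forallP H] /and3P[_ _ /existsP[r /andP[rq]]].
  by apply/negP; have := H r; rewrite rq.
move=> /orP[A|A] /orP[B|B].
- by case/andP: A => /eqP <- _; case/andP: B => /eqP <- _.
- by case: (aux _ _ _ A B).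
- by case: (aux _ _ _ B A).
case/and3P: A => i1 /eqP e1 _; case/and3P: B => i2 /eqP e2 _.
by apply: (rk_inj HL i1 i2); lia.
Qed.

(** When [i] carries no boundary edge but is not free, the status changes from
    one edge of [i] to the next one, across a line [j]. The four chambers at the
    crossing then have a status that depends only on the side of [j], so that
    both edges of [j] there are boundary edges. *)
Lemma charge_ex i : i \in nonfree -> exists2 p, p \in bdry & charge i p.
Proof.
rewrite inE negb_or => /andP[nt nf].
have [r ri|nb] := pickP [pred r : 'I_#|I| | (i, r) \in bdry].
  pose r0 := [arg min_(r' < r | (i, r') \in bdry) (r' : nat)].
  have [/= r1 r1b r1min] : extremum_spec leq (fun r' : 'I_#|I| => (i, r') \in bdry) (@nat_of_ord _) r0.
    exact: arg_minnP.
  exists (i, r1) => //; apply/orP; left; rewrite eqxx /=.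
  apply/forallP => r2; apply/implyP; rewrite ltnNge; apply: contra => /r1min //.
have nbE r b : (r < #|I|)%N -> (edge i r b \in S) = (edge i r true \in S).
  move=> rI; have := nb (Ordinal rI); rewrite !inE /= => /eqP H.
  by case: b; rewrite // -H.
have [r r1I ne] : exists2 r, (r.+1 < #|I|)%N &
    (edge i r true \in S) != (edge i r.+1 true \in S).
  apply: contrapT => H.
  have E r : (r < #|I|)%N -> (edge i r true \in S) = (edge i 0 true \in S).
    elim: r => // r IHr rI; rewrite -IHr ?(ltnW rI) //; apply/esym/eqP.
    by apply: contrapT => ne; apply: H; exists r => //; apply/negP.
  case: (boolP (edge i 0 true \in S)) => e0; [move/negP: nt|move/negP: nf]; apply;
  by apply/forallP => r; apply/forallP => b; rewrite nbE ?E // ?e0 // (negbTE e0).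
have [j ij rj] := rk_onto i r1I.
have ji : j != i by rewrite eq_sym.
have jlt := rk_lt HL ji.
have bj (e : bool) (lt : (rk j i + e < #|I|)%N) : (j, Ordinal lt) \in bdry.
  rewrite inE /=.
  rewrite (edge_vertex HL e true ji) (edge_vertex HL e false ji) !nbE //.
  - rewrite -rj in ne; case: (o i j) => //=; rewrite ?addn0 ?addn1 //.
    by rewrite eq_sym.
  - by rewrite rj; case: (_ (+) _); rewrite /= ?addn1 // addn0 ltnW.
  - by rewrite rj; case: (_ (+) _); rewrite /= ?addn1 // addn0 ltnW.
have l1 : (rk j i + true < #|I|)%N by rewrite addn1.
have l0 : (rk j i + false < #|I|)%N by rewrite addn0 ltnW.
exists (j, Ordinal l1); first exact: bj.
apply/orP; right; rewrite ji /= addn1 eqxx /=.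
by apply/existsP; exists (Ordinal l0); rewrite bj /= addn0 ltnSn.
Qed.

Lemma nonfree_le : (#|nonfree| <= #|bdry|)%N.
Proof.
apply: (@leq_card_rel _ _ charge); first exact: charge_ex.
exact: charge_inj.
Qed.

(** The chambers around the crossing of two free lines touch both of them. *)
Lemma free_same s0 s1 i j : free s0 i -> free s1 j -> s0 = s1.
Proof.
move=> fi fj; have [eij|ij] := eqVneq i j.
  by rewrite -(freeP true fi (card_gt0I i)) -(freeP true fj (card_gt0I j)) eij.
have ji : j != i by rewrite eq_sym.
have lt k l (e : bool) : k != l -> (rk k l + e < #|I|)%N.
  by move=> /(rk_lt HL); case: e => /=; lia.
rewrite -(freeP true fi (lt i j true ij)).
by rewrite (edge_vertex HL true true ij) (freeP _ fj) ?lt.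
Qed.

(** A chamber whose status is not [s0] touches no free line, so the first line
    crossed on the way to any other chamber is in [nonfree]. Its trace on
    [nonfree] is therefore shared with no other chamber, and in particular with
    none along [i0]. *)
Lemma minority_le s0 i0 : free s0 i0 ->
  (#|[set s in Sg | (s \in S) != s0]%SET| <= 'C(#|nonfree|, 2))%N.
Proof.
move=> f0; set D := [set s in Sg | _]%SET.
have i0P : i0 \notin nonfree.
  by rewrite inE negbK; case: s0 f0 {D} => ->; rewrite ?orbT.
(* [first_crossing] leaves [s] through a line of [nonfree]. *)
have key s t : s \in D -> t \in Sg -> agree_on nonfree s t -> s = t.
  rewrite inE => /andP[sS sD] tS st; apply: contrapT => /eqP ne.
  have [j [r [rI sj E]]] := first_crossing HL sS tS ne.
  have : j \notin nonfree by apply: contra sj => /st ->.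
  rewrite inE negbK => fj; move/negP: sD; apply; rewrite E.
  by case/orP: fj => fj; rewrite (freeP _ fj rI) (free_same f0 fj).
have Dinj : {in D &, injective (trace nonfree)}.
  move=> s t sD tD /eq_traceP; apply: key => //.
  by move: tD; rewrite inE => /andP[].
have sub : ([set trace nonfree s | s in D] :|: line_traces nonfree i0)%SET
    \subset traces nonfree.
  apply/fintype.subsetP => y; rewrite inE => /orP[] /imsetP[x xD ->].
    by apply: imset_f; move: xD; rewrite inE => /andP[].
  exact/imset_f/(edge_in HL).
have dis : ([set trace nonfree s | s in D] :&: line_traces nonfree i0 = finset.set0)%SET.
  apply/eqP/set0Pn => -[y]; rewrite inE => /andP[/imsetP[s sD ->] /imsetP[r _]].
  move/eq_traceP => /(key _ _ sD) E; move: sD; rewrite E ?(edge_in HL) //.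
  by rewrite inE (freeP _ f0) // eqxx andbF.
have U := cardsUI ([set trace nonfree s | s in D]) (line_traces nonfree i0).
rewrite dis cards0 addn0 (card_in_imset Dinj) in U.
have := leq_trans (subset_leq_card sub) (traces_le nonfree).
rewrite U => le; rewrite -(leq_add2r #|nonfree|.+1).
rewrite [leqRHS]addnC -[_.+1]/(1 + _)%N; apply: leq_trans le.
by rewrite leq_add2l; exact: line_traces_ge.
Qed.

Theorem bdry_isoperimetry : S \subset Sg -> (2 * #|S| <= #|Sg|)%N ->
  (#|S| <= 1 + 'C(#|bdry|, 2))%N.
Proof.
move=> SS half.
have [i0 fi0 | nofree] := pickP [pred i | free true i || free false i].
  have [s0 f0] : exists s0, free s0 i0.
    by case/orP: fi0 => ?; [exists true|exists false].
  have := minority_le f0; have := leq_bin2l 2 nonfree_le.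
  have : (#|S| <= #|[set s in Sg | (s \in S) != s0]%SET|)%N; last by lia.
  case: s0 {f0} => /=.
    have -> : [set s in Sg | (s \in S) != true]%SET = (Sg :\: S)%SET.
      by apply/setP => s; rewrite !inE eqb_id andbC.
    rewrite cardsD (finset.setIidPr SS) leq_subRL ?(subset_leq_card SS) //.
    by rewrite addnn -mul2n.
  apply/subset_leq_card/fintype.subsetP => s sS.
  by rewrite inE sS (fintype.subsetP SS).
have nI : (#|I| <= #|bdry|)%N.
  apply: leq_trans nonfree_le; rewrite -cardsT; apply/subset_leq_card.
  by apply/fintype.subsetP => i _; rewrite inE; have /= -> := nofree i.
have Sgle : (#|Sg| <= 1 + #|I| + 'C(#|I|, 2))%N.
  rewrite -(cardsT I); apply: leq_trans (traces_le [set: I]%SET).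
  rewrite card_in_imset // => s t _ _ /eq_traceP st.
  by apply/ffunP => k; apply: st; rewrite inE.
apply: leq_trans (_ : 1 + 'C(#|I|, 2) <= _)%N; last by rewrite leq_add2l leq_bin2l.
have : (#|I| <= 1 + 'C(#|I|, 2))%N; last by lia.
by rewrite bin2; case: (#|I|) => [|[|[|m]]] //=; nia.
Qed.

End Boundary.
End LineOrders.

(** * Sign vectors of lines in general position *)

Local Open Scope ring_scope.

Section Geometry.
Variables (R : realType) (I : finType) (a b c : I -> R).

Definition form (i : I) (p : R * R) : R := a i * p.1 + b i * p.2 - c i.

Definition det (i k : I) : R := a i * b k - a k * b i.

Record general_forms : Prop := GeneralForms {
  normal_neq0 : forall i, a i ^+ 2 + b i ^+ 2 != 0;
  det_neq0 : forall i k, i != k -> det i k != 0;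
  no_triple_point : forall i j k p, i != j -> i != k -> j != k ->
    form i p = 0 -> form j p = 0 -> form k p != 0 }.

Hypothesis HG : general_forms.

Lemma norm_gt0 i : 0 < a i ^+ 2 + b i ^+ 2.
Proof. by rewrite lt_neqAle eq_sym (normal_neq0 HG) addr_ge0 ?sqr_ge0. Qed.

(** The base point, at [t = 0], is the foot of the perpendicular from the
    origin. *)
Definition line_pt (i : I) (t : R) : R * R :=
  (a i * c i / (a i ^+ 2 + b i ^+ 2) - t * b i,
   b i * c i / (a i ^+ 2 + b i ^+ 2) + t * a i).

(** The parameter at which line [i] meets line [k], see [form_cross]. *)
Definition cross (i k : I) : R := - form k (line_pt i 0) / det i k.

Lemma form_line_pt i t : form i (line_pt i t) = 0.
Proof. by have D := normal_neq0 HG i; rewrite /form /=; field. Qed.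

Lemma form_cross i k t : i != k -> form k (line_pt i t) = det i k * (t - cross i k).
Proof.
move=> ik; rewrite /cross mulrBr mulrCA divff ?(det_neq0 HG) // mulr1 opprK.
by rewrite /form /det /=; ring.
Qed.

Lemma cross_inj i j k : i != j -> i != k -> cross i j = cross i k -> j = k.
Proof.
move=> ij ik e; apply: contrapT => /eqP jk.
have := no_triple_point HG ij ik jk (form_line_pt i (cross i j)).
rewrite !form_cross // e !subrr !mulr0 => /(_ erefl); by rewrite eqxx.
Qed.

Lemma form_uniq i j p q : i != j -> form i p = 0 -> form j p = 0 ->
  form i q = 0 -> form j q = 0 -> p = q.
Proof.
move=> ij; case: p q => p1 p2 [q1 q2]; rewrite /form /= => ip jp iq jq.
have D := det_neq0 HG ij.
have E1 : det i j * (p1 - q1) = 0.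
  rewrite (_ : _ * _ = b j * (a i * p1 + b i * p2 - c i - (a i * q1 + b i * q2 - c i))
   - b i * (a j * p1 + b j * p2 - c j - (a j * q1 + b j * q2 - c j))).
    by rewrite ip jp iq jq; ring.
  by rewrite /det; ring.
have E2 : det i j * (p2 - q2) = 0.
  rewrite (_ : _ * _ = a i * (a j * p1 + b j * p2 - c j - (a j * q1 + b j * q2 - c j))
   - a j * (a i * p1 + b i * p2 - c i - (a i * q1 + b i * q2 - c i))).
    by rewrite ip jp iq jq; ring.
  by rewrite /det; ring.
move/eqP: E1; rewrite mulf_eq0 (negbTE D) subr_eq0 /= => /eqP ->.
by move/eqP: E2; rewrite mulf_eq0 (negbTE D) subr_eq0 /= => /eqP ->.
Qed.

Lemma cross_sym i j : i != j -> line_pt i (cross i j) = line_pt j (cross j i).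
Proof.
move=> ij; have ji : j != i by rewrite eq_sym.
by apply: (form_uniq ij); rewrite ?form_line_pt // form_cross // subrr mulr0.
Qed.

Lemma on_line_pt i p : form i p = 0 -> exists t, p = line_pt i t.
Proof.
move=> ip; exists ((a i * p.2 - b i * p.1) / (a i ^+ 2 + b i ^+ 2)).
have D := normal_neq0 HG i.
have E : c i = a i * p.1 + b i * p.2 by move: ip; rewrite /form => /subr0_eq.
by rewrite /line_pt E; case: p {ip E} => x y /=; congr pair; field.
Qed.

Definition rank (i k : I) : nat := #|[set l | (l != i) && (cross i l < cross i k)]%SET|.

Definition orient (i k : I) : bool := det i k < 0.

(** An initial segment of the crossings of line [i] is the set of crossings of
    rank less than its size; this turns any position on the line into a rank. *)
Lemma rank_lt_down i (D : pred I) k :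
  (forall l l', l != i -> l' != i -> cross i l' <= cross i l -> D l -> D l') ->
  k != i -> (rank i k < #|[set l | (l != i) && D l]%SET|)%N = D k.
Proof.
move=> down ki; apply/idP/idP => [|Dk].
  apply: contraTT => Dk; rewrite -leqNgt; apply/subset_leq_card.
  apply/fintype.subsetP => l; rewrite !inE => /andP[li Dl]; rewrite li ltNge /=.
  by apply: contra Dk => kl; exact: down Dl.
apply: proper_card; apply/properP; split; last first.
  by exists k; rewrite !inE ?ki ?Dk // ltxx.
apply/fintype.subsetP => l; rewrite !inE => /andP[li lk]; rewrite li /=.
by apply: down Dk => //; exact: ltW.
Qed.

Lemma rank_ltE i k l : k != i -> (rank i k < rank i l)%N = (cross i k < cross i l).
Proof.
move=> ki; apply: (@rank_lt_down i (fun k => cross i k < cross i l)) => // k1 k2 _ _.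
exact: le_lt_trans.
Qed.

Lemma card_others i (D : pred I) : (#|[set l | (l != i) && D l]%SET| < #|I|)%N.
Proof.
rewrite -cardsT; apply: proper_card; apply/properP; split; first exact: finset.subsetT.
by exists i; rewrite !inE ?eqxx.
Qed.

Lemma rank_succ_lt i j : i != j -> ((rank i j).+1 < #|I|)%N.
Proof.
rewrite eq_sym => ji; apply: leq_trans (card_others i predT).
by rewrite ltnS rank_lt_down.
Qed.

Lemma rank_inj i j k : i != j -> i != k -> rank i j = rank i k -> j = k.
Proof.
move=> ij ik e; apply: (cross_inj ij ik); apply/eqP.
by rewrite eq_le !leNgt -!rank_ltE ?e ?ltnn // eq_sym.
Qed.

Definition sgn (p : R * R) : {ffun I -> bool} := [ffun i => 0 < form i p].

Definition generic (p : R * R) := forall i, form i p != 0.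

Definition regions : {set {ffun I -> bool}} :=
  [set s | `[< exists2 p, generic p & sgn p = s >]]%SET.

Lemma regionsP s : reflect (exists2 p, generic p & sgn p = s) (s \in regions).
Proof. by rewrite inE; exact: asboolP. Qed.

Local Notation edge := (edge rank orient).

Lemma form_line_pt_gt0 i k t : i != k -> cross i k != t ->
  (0 < form k (line_pt i t)) = (cross i k < t) (+) orient i k.
Proof.
move=> ik; rewrite form_cross // /orient; have := det_neq0 HG ik.
rewrite !neq_lt => /orP[d0|d0] /orP[ct|ct].
- by rewrite nmulr_rgt0 // d0 ct subr_lt0 ltNge (ltW ct).
- by rewrite nmulr_rgt0 // d0 subr_lt0 ct ltNge (ltW ct).
- by rewrite pmulr_rgt0 // subr_gt0 (ltNge (det i k)) (ltW d0) addbF.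
- by rewrite pmulr_rgt0 // subr_gt0 (ltNge (det i k)) (ltW d0) addbF.
Qed.

Lemma edge_vertexP i j (e e' : bool) : i != j ->
  edge i (rank i j + e) e' = edge j (rank j i + (e' (+) orient j i)) (e (+) orient i j).
Proof.
move=> ij; have ji : j != i by rewrite eq_sym.
have ranke k l (x : bool) : (rank k l < rank k l + x)%N = x.
  by case: x; rewrite ?addn1 ?addn0 ?ltnSn ?ltnn.
apply/ffunP => k; rewrite !ffunE.
have [->|ki] := eqVneq k i; first by rewrite (negbTE ij) ranke -addbA addbb addbF.
have [->|kj] := eqVneq k j; first by rewrite ranke.
have aux l m (x : bool) : k != l -> k != m -> l != m ->
    (rank l k < rank l m + x)%N (+) orient l k = (0 < form k (line_pt l (cross l m))).
  move=> kl km lm; have lk : l != k by rewrite eq_sym.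
  have ml : m != l by rewrite eq_sym.
  have ne : cross l k != cross l m.
    by apply/eqP => /(cross_inj lk lm)/eqP; rewrite (negbTE km).
  rewrite form_line_pt_gt0 //; congr (_ (+) _).
  case: x; rewrite ?addn0 ?rank_ltE // addn1 ltnS leqNgt rank_ltE // -leNgt.
  by rewrite le_eqVlt (negbTE ne).
by rewrite !aux // cross_sym.
Qed.

(** The hypothesis allows a line of [P] to pass through the point, with any sign
    in [s]. At most one line besides [i] does, as no three are concurrent, so it
    suffices to choose the edge of [i] before or after that point. *)
Lemma edge_at i t (P : {set I}) (s : {ffun I -> bool}) : i \notin P ->
  (forall k, k \in P -> form k (line_pt i t) != 0 -> s k = (0 < form k (line_pt i t))) ->
  exists2 r, (r < #|I|)%N & forall e, agree_on P s (edge i r e).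
Proof.
move=> iP sP.
(* A line passing through the point counts as crossed according to [s]. *)
pose D l := (cross i l < t) || [&& cross i l == t, l \in P & s l (+) orient i l].
exists #|[set l | (l != i) && D l]%SET|; first exact: card_others.
move=> e k kP; have ki : k != i by apply: contraNneq iP => <-.
have ik : i != k by rewrite eq_sym.
rewrite ffunE (negbTE ki) rank_lt_down //; last first.
  move=> l l' li l'i le /orP[lt|/and3P[/eqP lt lP sl]]; rewrite /D.
    by rewrite (le_lt_trans le lt).
  move: le; rewrite lt le_eqVlt => /orP[/eqP l't|->] //.
  suff -> : l' = l by rewrite lt eqxx lP sl orbT.
  by apply: (@cross_inj i); rewrite 1?eq_sym // l't.
rewrite /D; have [kt|kt] := eqVneq (cross i k) t.
  by rewrite kt ltxx kP /= -addbA addbb addbF.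
rewrite orbF -form_line_pt_gt0 //; apply: sP => //.
by rewrite form_cross // mulf_neq0 ?(det_neq0 HG) // subr_eq0 eq_sym.
Qed.

Definition seg (p q : R * R) (u : R) : R * R :=
  (p.1 + u * (q.1 - p.1), p.2 + u * (q.2 - p.2)).

Lemma form_seg i p q u : form i (seg p q u) = (1 - u) * form i p + u * form i q.
Proof. by rewrite /form /seg /=; ring. Qed.

Lemma seg_same_sign (x y u : R) : 0 <= u <= 1 -> x != 0 -> y != 0 -> (0 < x) = (0 < y) ->
  ((1 - u) * x + u * y != 0) /\ (0 < (1 - u) * x + u * y) = (0 < x).
Proof.
move=> /andP[u0 u1]; rewrite !neq_lt => /orP[x0|x0] /orP[y0|y0];
  rewrite ?x0 ?y0 ?(ltNge 0 x) ?(ltW x0) ?(ltNge 0 y) ?(ltW y0) //= => _.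
- have H : (1 - u) * x + u * y < 0 by nra.
  by rewrite H; split => //; apply/negbTE; rewrite -leNgt ltW.
- have H : 0 < (1 - u) * x + u * y by nra.
  by rewrite H orbT.
Qed.

Lemma crossing_time (x y : R) : (0 < x) != (0 < y) -> y != 0 -> x != 0 ->
  (0 <= x / (x - y) <= 1) /\ (1 - x / (x - y)) * x + x / (x - y) * y = 0.
Proof.
move=> ne y0 x0; have xy : x - y != 0.
  by apply: contraNneq ne => /subr0_eq ->.
split; last by field.
move: x0 y0 ne; rewrite !neq_lt => /orP[x0|x0] /orP[y0|y0];
  rewrite ?x0 ?y0 ?(ltNge 0 x) ?(ltW x0) ?(ltNge 0 y) ?(ltW y0) //= => _.
- have d0 : x - y < 0 by lra.
  by rewrite ler_ndivlMr // ler_ndivrMr //; apply/andP; split; lra.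
- have d0 : 0 < x - y by lra.
  by rewrite ler_pdivlMr // ler_pdivrMr //; apply/andP; split; lra.
Qed.

(** Here [x / (x - y)] is the time at which a form with values [x] and [y] at
    the ends of a segment vanishes on it. *)
Lemma before_crossing (u x y : R) : y != 0 -> x != 0 ->
  (0 < x) != (0 < y) -> u <= x / (x - y) -> (1 - u) * x + u * y != 0 ->
  (0 < x) = (0 < (1 - u) * x + u * y).
Proof.
move=> y0 x0 ne; move: x0 y0 ne; rewrite !neq_lt => /orP[x0|x0] /orP[y0|y0];
  rewrite ?x0 ?y0 ?(ltNge 0 x) ?(ltW x0) ?(ltNge 0 y) ?(ltW y0) //= => _.
- have d0 : x - y < 0 by lra.
  rewrite ler_ndivlMr // => H _.
  by apply/esym/negbTE; rewrite -leNgt; lra.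
- have d0 : 0 < x - y by lra.
  by rewrite ler_pdivlMr // => H /orP[] // H'; exfalso; lra.
Qed.

Lemma crossing_traceP (P : {set I}) i s t : s \in regions -> t \in regions ->
  agree_on P s t -> s i != t i ->
  exists2 r, (r < #|I|)%N & agree_on P s (edge i r true).
Proof.
move=> /regionsP[p gp <-] /regionsP[q gq <-] pq; rewrite !ffunE => ne.
have iP : i \notin P by apply: contra ne => /pq; rewrite !ffunE => ->.
pose u := form i p / (form i p - form i q).
have [u01 iu] : (0 <= u <= 1) /\ form i (seg p q u) = 0.
  have := gp i; have := gq i; rewrite form_seg /u; move: ne; move: (form i p) (form i q).
  exact: crossing_time.
have [t0 et] := on_line_pt iu.
suff H k : k \in P -> form k (line_pt i t0) != 0 -> sgn p k = (0 < form k (line_pt i t0)).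
  by have [r rI Hr] := edge_at iP H; exists r.
move=> kP _; rewrite -et form_seg.
have := pq k kP; rewrite !ffunE => e.
by rewrite (seg_same_sign u01 (gp k) (gq k) e).2.
Qed.

(** Take the earliest crossing [j] among the lines that separate the two
    chambers. Another line may be crossed at the same time, which [edge_at]
    allows, so the segment need not be in general position. *)
Lemma first_crossingP s t : s \in regions -> t \in regions -> s != t ->
  exists j r, [/\ (r < #|I|)%N, s j != t j & s = edge j r (s j)].
Proof.
move=> /regionsP[p gp <-] /regionsP[q gq <-] /eqP/ffunP ne.
have [i0 ni0] : exists i, sgn p i != sgn q i.
  apply: contrapT => H; apply: ne => k; apply/eqP; apply: contrapT => /negP nk.
  by apply: H; exists k.
pose u i := form i p / (form i p - form i q).
have [j nj umin] := @arg_minP _ _ _ i0 (fun i => sgn p i != sgn q i) u ni0.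
have [u01 ju] : (0 <= u j <= 1) /\ form j (seg p q (u j)) = 0.
  have := gp j; have := gq j; rewrite form_seg /u; move: nj; rewrite !ffunE.
  move: (form j p) (form j q); exact: crossing_time.
have [t0 et] := on_line_pt ju.
have jP : j \notin [set~ j]%SET by rewrite !inE eqxx.
have H k : k \in [set~ j]%SET -> form k (line_pt j t0) != 0 ->
    sgn p k = (0 < form k (line_pt j t0)).
  move=> _; rewrite -et form_seg.
  have [e|nk] := eqVneq (sgn p k) (sgn q k).
    move: e; rewrite !ffunE => e.
    by rewrite (seg_same_sign u01 (gp k) (gq k) e).2.
  have := umin k nk; move: nk; rewrite !ffunE /u -/(u j).
  have := gp k; have := gq k; move: (u j) (form k p) (form k q).
  exact: before_crossing.
have [r rI Hr] := edge_at jP H; exists j, r; split => //.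
apply/ffunP => k; have [->|kj] := eqVneq k j; first by rewrite [RHS]ffunE eqxx.
by apply: Hr; rewrite !inE.
Qed.

Lemma pos_lower_bound (J : finType) (d : J -> R) : (forall k, 0 < d k) ->
  exists2 e, 0 < e & forall k, e <= d k.
Proof.
move=> d0; exists (\big[Num.min/1]_k d k); last by move=> k; exact: bigmin_le_cond.
by apply/bigmin_gtP; split.
Qed.

(** Stop right after the last crossing of rank less than [r]; [m0] stands for
    a position before all crossings. *)
Lemma rank_threshold i r :
  exists t, forall k, i != k -> cross i k != t /\ (rank i k < r)%N = (cross i k < t).
Proof.
pose m0 := - (1 + \sum_k `|cross i k|).
have m0_lt k : m0 < cross i k.
  rewrite /m0 (bigD1 k) //=.
  have S0 : 0 <= \sum_(l | l != k) `|cross i l| by exact: sumr_ge0.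
  have := ler_norm (- cross i k); rewrite normrN; lra.
pose M := \big[Num.max/m0]_(k | (k != i) && (rank i k < r)%N) cross i k.
have M_ge k : k != i -> (rank i k < r)%N -> cross i k <= M.
  by move=> ki kr; apply: le_bigmax_cond; rewrite ki.
have M_lt k : k != i -> (r <= rank i k)%N -> M < cross i k.
  move=> ki kr; apply/bigmax_ltP; split => // l /andP[li lr].
  by rewrite -rank_ltE //; exact: leq_trans lr kr.
pose d k := if M < cross i k then (cross i k - M) / 2 else 1.
have [|e e0 ed] := @pos_lower_bound I d.
  by move=> k; rewrite /d; case: ifP => // Mk; rewrite divr_gt0 // subr_gt0.
exists (M + e) => k; rewrite eq_sym => ki.
have [kr|kr] := ltnP (rank i k) r.
  have lt : cross i k < M + e by have := M_ge k ki kr; lra.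
  by rewrite lt lt_eqF.
have Mk := M_lt k ki kr; have := ed k; rewrite /d Mk => ek.
have lt : M + e < cross i k by lra.
by rewrite gt_eqF // ltNge (ltW lt).
Qed.

(** The values [x k] are those of the forms at a point, and [y k] their
    variation in some direction: a short move keeps all the signs. *)
Lemma sign_stable (J : finType) (x y : J -> R) : (forall k, x k != 0) ->
  exists2 e, 0 < e & forall k, x k + e * y k != 0 /\ (0 < x k + e * y k) = (0 < x k).
Proof.
move=> x0; pose d k := `|x k| / (2 * (`|y k| + 1)).
have y1 k : 0 < `|y k| + 1 by rewrite ltr_wpDl.
have [|e e0 ed] := @pos_lower_bound J d.
  by move=> k; rewrite divr_gt0 ?normr_gt0 // mulr_gt0.
exists e => // k; have := ed k; rewrite /d ler_pdivlMr ?mulr_gt0 // => ek.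
have ey : `|e * y k| < `|x k|.
  have xk : 0 < `|x k| by rewrite normr_gt0.
  rewrite normrM (gtr0_norm e0); have := normr_ge0 (y k); nra.
move: ey (x0 k); move: (e * y k) (x k) => z w; rewrite ltr_norml => /andP[].
rewrite neq_lt => zl zr /orP[w0|w0].
- have H : w + z < 0 by move: zl zr; rewrite (ltr0_norm w0); lra.
  by rewrite lt_eqF //; split => //; rewrite !ltNge (ltW H) (ltW w0).
- have H : 0 < w + z by move: zl zr; rewrite (gtr0_norm w0); lra.
  by rewrite gt_eqF // H w0.
Qed.

(** Start from a point of line [i] between the right crossings, and move a little
    along the normal of the line to reach side [e]. *)
Lemma edge_in_regions i r e : edge i r e \in regions.
Proof.
have [t Ht] := rank_threshold i r.
pose x := line_pt i t.
pose y k := if e then a k * a i + b k * b i else - (a k * a i + b k * b i).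
have x0 (k : {k | k != i}) : form (val k) x != 0.
  have ki := valP k; have ik : i != val k by rewrite eq_sym.
  by rewrite form_cross // mulf_neq0 ?(det_neq0 HG) // subr_eq0 eq_sym (Ht _ ik).1.
have [d d0 Hd] := sign_stable (fun k : {k | k != i} => y (val k)) x0.
pose p := if e then (x.1 + d * a i, x.2 + d * b i) else (x.1 - d * a i, x.2 - d * b i).
have pE k : form k p = form k x + d * y k.
  by rewrite /p /y /form; case: e {y x0 Hd p} => /=; ring.
have ip : (form i p != 0) /\ (0 < form i p) = e.
  rewrite pE form_line_pt add0r /y -!expr2; have N := norm_gt0 i.
  case: e {y x0 Hd p pE}; first by rewrite gt_eqF ?mulr_gt0.
  rewrite mulrN oppr_eq0 gt_eqF ?mulr_gt0 // oppr_gt0; split => //.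
  by apply/negbTE; rewrite -leNgt ltW ?mulr_gt0.
have kp k (ki : k != i) : form k p != 0 /\ (0 < form k p) = (0 < form k x).
  by rewrite pE; exact: Hd (exist _ k ki).
apply/regionsP; exists p => [k|].
  by have [->|/kp[]] := eqVneq k i; first by case: ip.
apply/ffunP => k; rewrite !ffunE; have [->|ki] := eqVneq k i; first by case: ip.
have ik : i != k by rewrite eq_sym.
have [kt ->] := Ht _ ik.
by rewrite (kp k ki).2 form_line_pt_gt0.
Qed.

Theorem line_orders_regions : line_orders regions rank orient.
Proof.
split.
- exact: edge_in_regions.
- exact: edge_vertexP.
- exact: rank_succ_lt.
- exact: rank_inj.
- exact: first_crossingP.
- exact: crossing_traceP.
Qed.

End Geometry.

(** * Chambers as regions of a sign vector *)

Local Open Scope classical_set_scope.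
Local Open Scope ring_scope.

Lemma ncard_image (J : finType) (T : choiceType) (g : J -> T) (X : {set J}) :
  {in X &, injective g} -> ncard [set g x | x in [set` X]] = #|X|.
Proof.
move=> ginj; rewrite /ncard.
have -> : fset_set [set g x | x in [set` X]] = [fset g x | x in X]%fset.
  apply/fsetP => y; rewrite in_fset_set; last exact: finite_image.
  apply/idP/imfsetP => /= [|[x xX ->]]; last by rewrite inE; exists x.
  by rewrite inE => -[x xX <-]; exists x.
by rewrite card_in_imfset //= -cardE.
Qed.

Lemma ncard_le (T : choiceType) (A B : set T) : finite_set B -> A `<=` B ->
  (ncard A <= ncard B)%N.
Proof.
move=> fB AB; apply: fsubset_leq_card; rewrite -fset_set_sub //.
exact: sub_finite_set fB.
Qed.

Section Chambers.
Variables (R : realType) (I : finType) (a b c : I -> R).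
Hypothesis HG : general_forms a b c.

Local Notation form := (form a b c).
Local Notation generic := (generic a b c).
Local Notation sgn := (sgn a b c).
Local Notation regions := (regions a b c).
Local Notation edge := (edge (rank a b c) (orient a b)).

Definition zeros (i : I) : set (R * R) := [set p | form i p = 0].
Definition lines : set (set (R * R)) := range zeros.
Definition region (s : {ffun I -> bool}) : set (R * R) :=
  [set p | generic p /\ sgn p = s].

Lemma form_continuous i : continuous (form i).
Proof.
move=> p; have c1 : (fun p : R * R => p.1) @ p --> p.1 by exact: cvg_fst.
have c2 : (fun p : R * R => p.2) @ p --> p.2 by exact: cvg_snd.
exact: (cvgB (cvgD (cvgM (cvg_cst _) c1) (cvgM (cvg_cst _) c2)) (cvg_cst _)).
Qed.

Lemma seg_continuous (p q : R * R) : continuous (seg p q).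
Proof.
move=> u; have affine (x y : R) : x + v * (y - x) @[v --> u] --> x + u * (y - x).
  exact: (cvgD (cvg_cst x) (cvgM cvg_id (cvg_cst (y - x)))).
exact: (cvg_pair (affine p.1 q.1) (affine p.2 q.2)).
Qed.

Lemma seg0 (p q : R * R) : seg p q 0 = p.
Proof. by case: p => x y; rewrite /seg !mul0r !addr0. Qed.

Lemma seg1 (p q : R * R) : seg p q 1 = q.
Proof. by case: p q => x y [z w]; rewrite /seg /= !mul1r !subrKC. Qed.

Lemma arr_complE : arr_compl lines = generic.
Proof.
apply/seteqP; split => p.
  by move=> H i; apply/eqP => ip; apply: H; exists (zeros i) => //; exists i.
by move=> gp [_ [i _ <-]] /eqP; rewrite (negbTE (gp i)).
Qed.

(** A connected set that avoids the lines keeps all signs, by the intermediate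
    value theorem; conversely a region of constant sign is star-shaped. *)
Lemma componentE p : generic p ->
  connected_component (arr_compl lines) p = region (sgn p).
Proof.
move=> gp; rewrite arr_complE; apply/seteqP; split => q.
  move=> [C [Cp CA Cc] Cq]; split; first exact: CA.
  apply/ffunP => i; rewrite !ffunE; apply: contrapT => ne.
  have /connected_intervalP itv : connected (form i @` C).
    apply: connected_continuous_connected => //.
    by apply: continuous_subspaceT; exact: form_continuous.
  suff [r Cr r0] : (form i @` C) 0 by move: (CA _ Cr i); rewrite r0 eqxx.
  have fp : (form i @` C) (form i p) by exists p.
  have fq : (form i @` C) (form i q) by exists q.
  have := gp i; rewrite neq_lt => /orP[p0|p0];
    have := CA _ Cq i; rewrite neq_lt => /orP[q0|q0].
  - by case: ne; rewrite !(ltNge 0) (ltW p0) (ltW q0).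
  - by apply: itv fp fq _ _; rewrite (ltW p0) (ltW q0).
  - by apply: itv fq fp _ _; rewrite (ltW p0) (ltW q0).
  - by case: ne; rewrite p0 q0.
move=> [gq sq]; apply: (@connected_component_max _ _ (seg p q @` `[0, 1])).
- by exists 0; rewrite ?seg0 //= in_itv /= lexx ler01.
- move=> _ [u /= u01 <-] i; rewrite form_seg.
  rewrite in_itv /= in u01.
  have e : sgn p i = sgn q i by rewrite sq.
  by rewrite !ffunE in e; exact: (seg_same_sign u01 (gp i) (gq i) e).1.
- apply: connected_continuous_connected; first exact: segment_connected.
  by apply: continuous_subspaceT; exact: seg_continuous.
- by exists 1; rewrite ?seg1 //= in_itv /= lexx ler01.
Qed.

Lemma chambersE : chambers lines = [set region s | s in [set` regions]].
Proof.
apply/seteqP; split => C.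
  move=> [p cp <-]; have gp : generic p by rewrite arr_complE in cp.
  rewrite componentE //.
  by exists (sgn p) => //=; apply/regionsP; exists p.
move=> [s /= /regionsP[p gp <-] <-]; exists p; first by rewrite arr_complE.
exact: componentE.
Qed.

Lemma region_inj : {in regions &, injective region}.
Proof.
move=> s t /regionsP[p gp <-] _ e.
by have [] : region t p by rewrite -e.
Qed.

(** A point where the forms agree weakly with [s] is the limit of the points of a
    segment that goes from it to any point of the open region. *)
Lemma closure_region s p : s \in regions ->
  closure (region s) p <-> (forall k, form k p != 0 -> s k = (0 < form k p)).
Proof.
move=> /regionsP[q gq sq]; split.
  move=> cp k; rewrite neq_lt => /orP[p0|p0].
  - have [|r [[gr <-] /= r0]] := cp [set r | form k r < 0].
      exact: (@form_continuous k p _ (lt_nbhsl p0)).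
    by rewrite !ffunE !(ltNge 0) (ltW r0) (ltW p0).
  - have [|r [[gr <-] /= r0]] := cp [set r | 0 < form k r].
      exact: (@form_continuous k p _ (lt_nbhsr p0)).
    by rewrite !ffunE r0 p0.
move=> sgp B nB.
have : nbhs (0 : R) (seg p q @^-1` B).
  by apply: seg_continuous; rewrite seg0.
move=> /nbhs_ballP[e /= e0 eB].
pose u := Num.min (e / 2) 1.
have u0 : 0 < u by rewrite lt_min ltr01 andbT divr_gt0.
have u1 : u <= 1 by rewrite ge_min lexx orbT.
have ue : u < e by rewrite gt_min ltr_pdivrMr // ltr_pMr // ltr1n.
exists (seg p q u); split; last first.
  by apply: eB; rewrite /ball /= sub0r normrN gtr0_norm.
have E k : form k (seg p q u) != 0 /\ (0 < form k (seg p q u)) = s k.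
  rewrite form_seg -sq ffunE; have [->|p0] := eqVneq (form k p) 0.
    by rewrite mulr0 add0r mulf_neq0 ?(gt_eqF u0) ?gq // pmulr_rgt0.
  have e1 : (0 < form k p) = (0 < form k q) by rewrite -(sgp k p0) -sq ffunE.
  have u01 : 0 <= u <= 1 by rewrite (ltW u0).
  by have [? ->] := seg_same_sign u01 p0 (gq k) e1.
by split=> [k|]; [case: (E k) | apply/ffunP => k; rewrite ffunE; case: (E k)].
Qed.

(** A segment between the two regions crosses [i] at a point off the other lines;
    a short move along [i] gives a second point. *)
Lemma wall_points s t i : s \in regions -> t \in regions -> s i != t i ->
  (forall k, k != i -> s k = t k) ->
  exists p q, [/\ p <> q, form i p = 0, form i q = 0 &
    forall k, k != i -> (0 < form k p) = s k /\ (0 < form k q) = s k].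
Proof.
move=> /regionsP[x gx <-] /regionsP[y gy <-]; rewrite !ffunE => ne st.
have [u01 u0] := crossing_time ne (gy i) (gx i); rewrite -form_seg in u0.
set p := seg x y _ in u0.
have px k : k != i -> form k p != 0 /\ (0 < form k p) = sgn x k.
  move=> ki; rewrite form_seg [sgn x k]ffunE.
  by apply: seg_same_sign (gx k) (gy k) _ => //; have := st k ki; rewrite !ffunE.
have [d d0 Hd] := @sign_stable _ {k | k != i} (fun k => form (val k) p)
  (fun k => det a b i (val k)) (fun k => (px _ (valP k)).1).
pose q := (p.1 - d * b i, p.2 + d * a i).
have qE k : form k q = form k p + d * det a b i k by rewrite /form /det /=; ring.
exists p, q; split => //.
- rewrite /q; case: (p) => p1 p2 [] /= e1 e2.
  have b0 : d * b i = 0 by lra.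
  have a0 : d * a i = 0 by lra.
  have := norm_gt0 HG i.
  move/eqP: a0; rewrite mulf_eq0 (gt_eqF d0) /= => /eqP ->.
  move/eqP: b0; rewrite mulf_eq0 (gt_eqF d0) /= => /eqP ->.
  by rewrite expr0n addr0 ltxx.
- by rewrite qE u0 /det subrr mulr0 addr0.
- by move=> k ki; rewrite qE (Hd (exist _ k ki)).2 (px k ki).2.
Qed.

(** By [closure_region], the closures of both regions cut the same set on line
    [i], because [s] and [t] agree off [i]. *)
Lemma adjacent_regions s t i : s \in regions -> t \in regions -> s i != t i ->
  (forall k, k != i -> s k = t k) -> Defs.adjacent lines (region s) (region t).
Proof.
move=> sR tR ne st; split.
- by rewrite chambersE; exists s.
- by rewrite chambersE; exists t.
- by move=> /(region_inj sR tR) e; rewrite e eqxx in ne.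
have [p [q [pq ip iq H]]] := wall_points sR tR ne st.
have E : closure (region s) `&` zeros i = closure (region t) `&` zeros i.
  apply/seteqP; split => x [/closure_region cx ix]; split => //;
    apply/closure_region => // k k0; rewrite -(cx _ k k0) //;
    have [ki|ki] := eqVneq k i; rewrite ?st //; by rewrite ki ix eqxx in k0.
have F x : form i x = 0 -> (forall k, k != i -> (0 < form k x) = s k) ->
    (closure (region s) `&` zeros i) x.
  move=> ix kx; split => //; apply/closure_region => // k k0.
  have [ki|ki] := eqVneq k i; last by rewrite kx.
  by rewrite ki ix eqxx in k0.
have P2 : exists x y, [/\ (closure (region s) `&` zeros i) x,
    (closure (region s) `&` zeros i) y & x <> y].
  by exists p, q; split=> //; apply: F => // k /H[].
exists (closure (region s) `&` zeros i); split; split => //.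
- by exists (zeros i) => //; exists i.
- by exists (zeros i) => //; exists i.
Qed.

Lemma edge_boundary_finite S : finite_set (edge_boundary lines S).
Proof.
have fC : finite_set (chambers lines).
  by rewrite chambersE; exact: finite_image.
apply: (@sub_finite_set _ _ [set [set C; D] | C in chambers lines & D in chambers lines]).
  by move=> _ [[C [D [[CC DD _ _] ->]]] _]; exists C => //; exists D.
exact: finite_image2.
Qed.

(** Each boundary edge in the sense of [bdry] gives a distinct boundary edge of
    the chamber graph. *)
Theorem arrangement_isoperimetry (S : set (set (R * R))) :
  S `<=` chambers lines -> (2 * ncard S <= ncard (chambers lines))%N ->
  (ncard S <= 1 + 'C(ncard (edge_boundary lines S), 2))%N.
Proof.
move=> SC; have HL := line_orders_regions HG.
pose X := [set s in regions | `[< S (region s) >]]%SET.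
have inX s : s \in regions -> s \in X <-> S (region s).
  by move=> sR; rewrite inE sR; split=> /asboolP.
have XR : X \subset regions by apply/fintype.subsetP => s; rewrite inE => /andP[].
have SX : S = [set region s | s in [set` X]].
  apply/seteqP; split => C.
    move=> SC0; have := SC _ SC0; rewrite chambersE => -[s /= sR e].
    by exists s => //=; apply/inX => //; rewrite e.
  by move=> [s /= sX <-]; apply/inX => //; exact: fintype.subsetP sX.
have Xinj : {in X &, injective region}.
  by move=> s t sX tX; apply: region_inj; apply: (fintype.subsetP XR).
rewrite chambersE (ncard_image region_inj) [in ncard S]SX (ncard_image Xinj) => half.
apply: leq_trans (bdry_isoperimetry HL XR half) _.
rewrite leq_add2l leq_bin2l //.
pose wall (p : I * 'I_#|I|) : set (set (R * R)) :=
  [set region (edge p.1 p.2 true); region (edge p.1 p.2 false)].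
have eR i r e : edge i r e \in regions by exact: edge_in HL _ _ _.
have wall_inj : injective wall.
  move=> [i r] [i' r'] e.
  have mem (e0 : bool) : exists e1, edge i r e0 = edge i' r' e1.
    have : wall (i, r) (region (edge i r e0)) by case: e0; [left|right].
    by rewrite e => -[] /region_inj ->; rewrite ?eR //; [exists true|exists false].
  have [e1 E1] := mem true; have [e2 E2] := mem false.
  have [ii' rr'] := edge_eqP HL (ltn_ord r) (ltn_ord r') E1 E2.
  by congr pair => //; apply: val_inj.
rewrite -(ncard_image (in2W wall_inj)).
apply: ncard_le; first exact: edge_boundary_finite.
move=> _ [[i r] /= bp <-]; split.
  exists (region (edge i r true)), (region (edge i r false)); split => //.
  apply: (@adjacent_regions _ _ i); rewrite ?eR //; first by rewrite !ffunE eqxx.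
  by move=> k ki; rewrite !ffunE (negbTE ki).
have only (e : bool) : edge i r e \in X -> edge i r (~~ e) \notin X ->
    exists! C, (wall (i, r) `&` S) C.
  move=> eX neX; exists (region (edge i r e)); split.
    by split; [case: e {eX neX}; [left|right] | apply/inX].
  have nS : ~ S (region (edge i r (~~ e))) by move=> /inX; rewrite (negbTE neX) => /(_ (eR _ _ _)).
  by move=> C [[|] ->]; case: e nS {eX neX}.
move: bp; rewrite inE /= => bp.
have [eX|eX] := boolP (edge i r true \in X).
  by apply: (only true) => //; rewrite eX in bp; case: (_ \in X) bp.
by apply: (only false) => //; rewrite (negbTE eX) in bp; case: (_ \in X) bp.
Qed.

End Chambers.

(** * Arrangements given as sets of lines *)

Lemma real_binom_sum (R : realType) (k : R) :
  \sum_(i < 2) real_binom k i = k + 1 /\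
  \sum_(i < 3) real_binom k i = 1 + k * (k + 1) / 2.
Proof.
split; rewrite !big_ord_recl big_ord0 /real_binom /= !big_ord_recl !big_ord0 /=.
  by rewrite subr0 /bump /= !mulr1 !divr1 addr0 addrC.
rewrite /bump /= (_ : 2`!%:R = 2 :> R) // subr0 !mulr1 !divr1 addr0.
by field.
Qed.

(** Strict growth of x(x+1)/2 on the nonnegative reals, at x = k and x = m - 1;
    for m = 0 the hypotheses are contradictory. *)
Lemma isoperimetric_inversion (R : realType) (k : R) (s m : nat) : 1 <= k ->
  s%:R = 1 + k * (k + 1) / 2 -> (s <= 1 + 'C(m, 2))%N -> k + 1 <= m%:R.
Proof.
move=> k1 sE; rewrite -(ler_nat R) sE natrD lerD2l.
have -> : 'C(m, 2)%:R = m%:R * (m%:R - 1) / 2 :> R.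
  elim: m => [|m IHm]; first by rewrite bin0n !mul0r.
  by rewrite binS bin1 natrD IHm -natr1; field.
have [m0 | m0] : (m = 0%N) \/ 1 <= m%:R :> R.
- by case: m => [|m]; [left|right; rewrite ler1n].
- by rewrite m0; nra.
by move=> H; rewrite leNgt; apply/negP => mk; nra.
Qed.

(** Two forms with proportional normals and a common zero vanish on the same
    line, so a unique common point makes the determinant nonzero. *)
Lemma lines_of_arrangement (R : realType) (H : set (set (R * R)%type)) :
  line_arrangement H -> general_position H ->
  exists (I : finType) (a b c : I -> R), general_forms a b c /\ H = lines a b c.
Proof.
move=> [finH affH] [meet2 meet3].
pose I : finType := fset_set H.
have HI (i : I) : H (val i).
  by have := valP i; rewrite in_fset_set // inE.
have /choice[f fP] : forall i : I, exists abc : R * R * R,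
    (abc.1.1, abc.1.2) != (0, 0) /\
    val i = [set p : R * R | abc.1.1 * p.1 + abc.1.2 * p.2 = abc.2].
  by move=> i; have [a [b [c [n0 E]]]] := affH _ (HI i); exists (a, b, c).
pose a i := (f i).1.1; pose b i := (f i).1.2; pose c i := (f i).2.
have valE i : val i = zeros a b c i.
  rewrite (fP i).2; apply/seteqP; split => p /=; rewrite /zeros /= /form.
    by move=> ->; rewrite subrr.
  by move/subr0_eq.
have neq (i j : I) : i != j -> val i <> val j by move=> /eqP ij /val_inj.
exists I, a, b, c; split; last first.
  apply/seteqP; split => [l Hl|_ [i _ <-]]; last by rewrite -valE.
  have lI : l \in fset_set H by rewrite in_fset_set // inE.
  by exists [` lI]%fset => //; rewrite -valE.
have norm0 i : a i ^+ 2 + b i ^+ 2 != 0.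
  rewrite paddr_eq0 ?sqr_ge0 // !sqrf_eq0.
  by have := (fP i).1; rewrite xpair_eqE.
split => // [i k ik | i j k p ij ik jk ip jp].
  have [p [[pi pk] pu]] := meet2 _ _ (HI i) (HI k) (neq _ _ ik).
  apply/eqP => D.
  pose q := (p.1 - b i, p.2 + a i).
  have pq : p = q.
    apply: pu; rewrite !valE /zeros /=; rewrite !valE /zeros /= in pi pk.
    split => /=; [rewrite -[RHS]pi | rewrite -[RHS]pk (_ : form a b c k q = form a b c k p + det a b i k)].
    - by rewrite /form /q /=; ring.
    - by rewrite D addr0.
    - by rewrite /form /det /q /=; ring.
  move: (norm0 i); move: pq; rewrite /q; case: (p) => x y [] /= e1 e2.
  have -> : b i = 0 by lra.
  have -> : a i = 0 by lra.
  by rewrite expr0n addr0 eqxx.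
apply/eqP => kp; have : (val i `&` val j `&` val k) p by rewrite !valE.
by rewrite (meet3 _ _ _ (HI i) (HI j) (HI k)) //; exact: neq.
Qed.

Theorem theorem4p1 (R : realType) (H : set (set (R * R)%type))
    (S : set (set (R * R)%type)) (k : R) :
  line_arrangement H -> general_position H ->
  S `<=` chambers H -> (2 * ncard S <= ncard (chambers H))%N ->
  1 <= k -> (ncard S)%:R = \sum_(i < 3) real_binom k i ->
  \sum_(i < 2) real_binom k i = k + 1 /\
  \sum_(i < 2) real_binom k i <= (ncard (edge_boundary H S))%:R :> R.
Proof.
move=> arrH gpH SC half k1; have [-> ->] := real_binom_sum k => Sk; split=> //.
have [I [a [b [c [HG EH]]]]] := lines_of_arrangement arrH gpH.
apply: isoperimetric_inversion k1 Sk _; rewrite EH in SC half *.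
exact: arrangement_isoperimetry.
Qed.
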